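(* Let $X,Y$ be Hilbert spaces, $F:X\to Y$, $x_0\in X$, $\rho>0$, and assume that $F$ is continuously Fréchet differentiable and that there is $C>0$ with $\|F'(x)\|\le C$ for all $x\in B_\rho(x_0)$. Let $y\in \mathrm{Rg}(F)$ (the range of $F$), let $(\delta^j)_{j\in\mathbb{N}}$ be a sequence of positive numbers converging to zero, and let $(y^{\delta^j})$ be a sequence in $Y$ with $\|y^{\delta^j}-y\|\le\delta^j$. For each $j\in\mathbb{N}$, let $(x_l^{\delta^j})_{l=0}^{k_j^*+1}$ and $(w_l^{\delta^j})_{l=0}^{k_j^*}$ be the sequences generated by the noisy-data inertial Levenberg-Marquardt (inLM) iteration with data $y^{\delta^j}$, noise level $\delta^j$, parameters $(\lambda_k)$ and $(\alpha_k^{\delta^j})$, where $k_j^*$ is the corresponding stopping index and $(\alpha_k^{\delta^j})$ is given by the noisy-data inertial parameter rule. Let $(x_k)$ and $(w_k)$ be the sequences generated by the exact-data inLM iteration with data $y$, with $(\alpha_k)$ given by the exact-data inertial parameter rule. Then for each $k\ge0$, $$\lim_{j\to\infty}x_k^{\delta^j}=x_k\quad\text{and}\quad\lim_{j\to\infty}w_k^{\delta^j}=w_k,$$ where, if the exact-data iteration stops at an index $k_0$ (so that the sequences are $x_0,\dots,x_{k_0+1}$ and $w_0,\dots,w_{k_0}$), the first limit holds for $k=0,\dots,k_0+1$ and the second for $k=0,\dots,k_0$.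
   Context: $B_r(x_0):=\{x\in X:\|x-x_0\|\le r\}$. The same $x_0$, $\alpha$ and $(\lambda_k)$ are used in the exact-data and in all noisy-data iterations. Exact-data inLM iteration: given an initial guess $x_0\in X$, a constant $\alpha\in[0,1)$ and positive reals $(\lambda_k)_{k\ge0}$, set $w_0:=x_0$. For $k=0,1,\dots$: if $\|F(w_k)-y\|>0$, let $A_k:=F'(w_k)$ with adjoint $A_k^*$, let $s_k\in X$ be the unique solution of $(A_k^*A_k+\lambda_k I)s_k=A_k^*(y-F(w_k))$, set $x_{k+1}:=w_k+s_k$, choose $\alpha_{k+1}\in[0,\alpha]$, and set $w_{k+1}:=x_{k+1}+\alpha_{k+1}(x_{k+1}-x_k)$; otherwise set $s_k:=0$, $x_{k+1}:=w_k$ and stop. Noisy-data inLM iteration (data $y^\delta$, noise level $\delta>0$): $x_0^\delta:=w_0^\delta:=x_0$; fix $\tau>(\eta+1)(q-\eta)^{-1}$, where $\eta\in[0,1)$ and $q\in(\eta,1)$ are fixed constants. For $k=0,1,\dots$: if $\|F(w_k^\delta)-y^\delta\|>\tau\delta$, let $A_k^\delta:=F'(w_k^\delta)$, let $s_k^\delta$ be the unique solution of $((A_k^\delta)^*A_k^\delta+\lambda_kI)s_k^\delta=(A_k^\delta)^*(y^\delta-F(w_k^\delta))$, set $x_{k+1}^\delta:=w_k^\delta+s_k^\delta$, choose $\alpha_{k+1}^\delta\in[0,\alpha]$ and set $w_{k+1}^\delta:=x_{k+1}^\delta+\alpha_{k+1}^\delta(x_{k+1}^\delta-x_k^\delta)$;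 otherwise set $s_k^\delta:=0$, $x_{k+1}^\delta:=w_k^\delta$, $k^*:=k$ (the stopping index) and stop. Thus $k^*=\min\{k:\|F(w_k^\delta)-y^\delta\|\le\tau\delta\}$. Exact-data inertial parameter rule: with $\theta_k:=1/k^2$, for $k\ge1$, $$\alpha_k:=\min\Big\{\frac{\theta_k}{\|x_k-x_{k-1}\|^2},\ \frac{\min\{\theta_k,\ \rho-\|x_k-x_0\|\}}{\|x_k-x_{k-1}\|},\ \alpha\Big\}\ \text{ if }\|x_k-x_{k-1}\|>0,\qquad \alpha_k:=0\ \text{ otherwise}.$$ Noisy-data inertial parameter rule: the same formula with $x_k,x_{k-1},\alpha_k$ replaced by $x_k^\delta,x_{k-1}^\delta,\alpha_k^\delta$. (Both rules are in addition to the requirement that inertial parameters lie in $[0,\alpha]$.) Since the noisy iterates are defined only up to the respective stopping index, each limit is understood along those $j$ for which the iterate in question is defined. *)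

(* Defs.v *)
From HB Require Import structures.
From mathcomp Require Import all_boot all_order all_algebra.
From mathcomp Require Import all_classical all_reals all_analysis.

Set Implicit Arguments.
Unset Strict Implicit.
Unset Printing Implicit Defensive.

Import Order.TTheory GRing.Theory Num.Theory.
Import numFieldNormedType.Exports.

Local Open Scope classical_set_scope.
Local Open Scope ring_scope.

(* Real Hilbert spaces: complete normed modules whose norm is induced by a
   positive definite symmetric bilinear form. *)
HB.mixin Record CompleteNormedModule_isHilbert (R : realType) (V : Type)
    of CompleteNormedModule R V := {
  inner : {dot V for @idfun R};
  inner_norm : forall u : V, inner u u = `|u| ^+ 2
}.

#[short(type="hilbertType")]
HB.structure Definition Hilbert (R : realType) :=
  { V of CompleteNormedModule_isHilbert R V & CompleteNormedModule R V }.

Section Operators.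
Context {R : realType} {X Y : hilbertType R}.

(* Meaningful for bounded A: [sup] of an unbounded set is the junk value 0. *)
Definition op_norm (A : X -> Y) : R :=
  sup [set `|A u| | u in [set u : X | `|u| <= 1]].

Definition is_adjoint (A : X -> Y) (B : Y -> X) : Prop :=
  forall u v, inner (A u) v = inner u (B v).

(* For A bounded and linear, the adjoint exists (Riesz) and is unique; the
   default value 0 is used only for maps having no adjoint. *)
Definition adjoint (A : X -> Y) : Y -> X :=
  xget (fun=> 0) [set B | is_adjoint A B].

Definition continuously_differentiable (F : X -> Y) : Prop :=
  (forall x, differentiable F x) /\
  (forall x, op_norm (fun u => 'd F z u - 'd F x u) @[z --> x] --> (0 : R)).

End Operators.

Section InertialLevenbergMarquardt.
Context {R : realType} {X Y : hilbertType R}.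
Implicit Types (F : X -> Y) (y : Y) (x w s : nat -> X) (lam a : nat -> R).

(* The iterates are total functions of the index.  No previous step has met
   the stopping test [`|F (w l) - y| <= thr], so that w_k is actually computed;
   values of the sequences beyond the stopping step are unconstrained. *)
Definition reached F y (thr : R) w (k : nat) : Prop :=
  forall l, (l < k)%N -> thr < `|F (w l) - y|.

Definition stops_at F y (thr : R) w (k : nat) : Prop :=
  reached F y thr w k /\ `|F (w k) - y| <= thr.

(* As mu > 0, the solution s is unique. *)
Definition LM_equation F y (mu : R) (w s : X) : Prop :=
  let A := 'd F w in
  adjoint A (A s) + mu *: s = adjoint A (y - F w).

(* Exact data: thr = 0; noisy data: thr = tau * delta. *)
Definition inLM F y (thr : R) (x0 : X) (alpha : R) lam x w s a : Prop :=
  [/\ x 0%N = x0, w 0%N = x0 &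
    forall k, reached F y thr w k ->
      if thr < `|F (w k) - y| then
        [/\ LM_equation F y (lam k) (w k) (s k),
            x k.+1 = w k + s k,
            0 <= a k.+1 <= alpha &
            w k.+1 = x k.+1 + a k.+1 *: (x k.+1 - x k)]
      else s k = 0 /\ x k.+1 = w k].

Definition theta (k : nat) : R := (k%:R ^+ 2)^-1.

(* Used for k >= 1 only. *)
Definition inertial_parameter (x0 : X) (rho alpha : R) x (k : nat) : R :=
  let d := `|x k - x k.-1| in
  if 0 < d then
    Num.min (theta k / d ^+ 2)
      (Num.min (Num.min (theta k) (rho - `|x k - x0|) / d) alpha)
  else 0.

Definition inertial_rule F y (thr : R) (x0 : X) (rho alpha : R) x w a : Prop :=
  forall k, reached F y thr w k.+1 ->
    a k.+1 = inertial_parameter x0 rho alpha x k.+1.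

(* Limit of the subfamily of u indexed by D, which has to be infinite for such
   a limit to make sense. *)
Definition lim_along (D : set nat) (u : nat -> X) (l : X) : Prop :=
  infinite_set D /\ u j @[j --> within D \oo] --> l.

End InertialLevenbergMarquardt.

(* Main.v *)
Require Import Defs.
From HB Require Import structures.
From mathcomp Require Import all_boot all_order all_algebra.
From mathcomp Require Import all_classical all_reals all_analysis.
From mathcomp Require Import ring lra.

Import Order.TTheory GRing.Theory Num.Theory.
Import numFieldNormedType.Exports.

Local Open Scope classical_set_scope.
Local Open Scope ring_scope.

(** For a fixed index [k] the iterates depend continuously on the data as long
    as the exact iteration has not stopped, and the limit follows by induction
    on [k].  Suppose that the exact iteration computes [w k], that all but
    finitely many noisy iterations do, and that [wd j k --> w k].

    - _Levenberg-Marquardt step_.  Continuity of [F'] gives convergence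
      of the residuals and of the derivatives in operator norm.  The step solves
      [(A^* A + mu) s = A^* r], and the energy identity for the difference of
      two such solutions ([LM_step_perturbation]) shows that it depends
      continuously on [A] and [r]; hence [xd j k.+1 --> x k.+1].  If the exact
      iteration stops at [k], its residual is zero, so its zero step solves the
      same equation, and the argument covers the noisy iterations that go on
      as well as those that stop ([LM_step_cvg], [LM_iterate_cvg]).
    - _Stopping test_.  If the exact iteration goes on, then
      [0 < |F (w k) - y|], the limit of [|F (wd j k) - yd j|], whereas the
      thresholds tend to zero: almost all noisy iterations go on as well
      ([noisy_reachedS]).
    - _Inertial step_.  The inertial parameter is continuous in the iterates
      where [x k.+1 <> x k].  It may jump where [x k.+1 = x k], but it
      multiplies [xd j k.+1 - xd j k], which tends to zero there, and it is
      bounded by [alpha] ([inertial_step_cvg]).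

    The equation of the step involves an adjoint defined by choice, with a
    default value for maps that have none.  It has its meaning only once
    bounded operators are known to have adjoints; this comes from
    completeness, through the Riesz representation theorem
    ([riesz_representation], [adjointP]). *)

(** * Limits *)

Section Convergence.
Context {R : realType} {T : Type} {G : set_system T} {FG : Filter G}.

Lemma cvg_dist_le (V : normedModType R) (f : T -> V) (g : T -> R) (l : V) :
  (\forall j \near G, `|f j - l| <= g j) -> g j @[j --> G] --> (0 : R) ->
  f j @[j --> G] --> l.
Proof.
move=> fg g0; apply/cvgrPdistC_lt => e e0.
have /cvgr0_norm_lt/(_ e e0) := g0.
apply: filterS2 fg => j fgj; exact/le_lt_trans/(le_trans fgj)/ler_norm.
Qed.

Lemma cvg_dist (V : normedModType R) (f : T -> V) (l : V) :
  f j @[j --> G] --> l -> `|f j - l| @[j --> G] --> (0 : R).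
Proof.
move=> fl; rewrite -(@normr0 _ V) -(subrr l).
apply: cvg_norm; apply: cvgB => //; exact: cvg_cst.
Qed.

Lemma cvg_sqr (f : T -> R) (l : R) :
  f j @[j --> G] --> l -> f j ^+ 2 @[j --> G] --> l ^+ 2.
Proof. by move=> fl; rewrite expr2; apply: cvgM. Qed.

Lemma cvg_min (f g : T -> R) (k l : R) : f j @[j --> G] --> k ->
  g j @[j --> G] --> l -> Num.min (f j) (g j) @[j --> G] --> Num.min k l.
Proof.
move=> fk gl; rewrite minr_absE; under eq_fun do rewrite minr_absE.
apply: cvgMr_tmp; apply: cvgB; first exact: cvgD.
by apply: cvg_norm; apply: cvgB.
Qed.

End Convergence.

Lemma near_infinite (D : set nat) :
  (\forall j \near \oo, D j) -> infinite_set D.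
Proof.
move=> [N _ ND]; apply: cofinite_set_infinite; first exact: infinite_nat.
apply: (sub_finite_set _ (finite_II N)) => j nDj.
by rewrite /= ltnNge; apply/negP => /ND.
Qed.

(** * Inner products and the Riesz representation theorem *)

Section InnerProduct.
Context {R : realType} {X : hilbertType R}.
Implicit Types u v z : X.

Lemma innerC u v : inner u v = inner v u.
Proof. by rewrite hermC expr0 mul1r. Qed.

Lemma innerDl u v z : inner (u + v) z = inner u z + inner v z.
Proof. exact: linearDl. Qed.

Lemma innerBl u v z : inner (u - v) z = inner u z - inner v z.
Proof. exact: linearBl. Qed.

Lemma innerZl c u z : inner (c *: u) z = c * inner u z.
Proof. exact: linearZl_LR. Qed.

Lemma innerDr u v z : inner z (u + v) = inner z u + inner z v.
Proof. by rewrite innerC innerDl !(innerC _ z). Qed.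

Lemma innerBr u v z : inner z (u - v) = inner z u - inner z v.
Proof. by rewrite innerC innerBl !(innerC _ z). Qed.

Lemma innerZr c u z : inner z (c *: u) = c * inner z u.
Proof. by rewrite innerC innerZl innerC. Qed.

Lemma sqr_normD u v : `|u + v| ^+ 2 = `|u| ^+ 2 + 2 * inner u v + `|v| ^+ 2.
Proof.
by rewrite -!inner_norm innerDl !innerDr (innerC v u); ring.
Qed.

Lemma sqr_normB u v : `|u - v| ^+ 2 = `|u| ^+ 2 - 2 * inner u v + `|v| ^+ 2.
Proof.
by rewrite -!inner_norm innerBl !innerBr (innerC v u); ring.
Qed.

(** Cauchy-Schwarz: since the norm is already known to satisfy the triangle
    inequality, squaring the latter is enough. *)
Lemma inner_le u v : inner u v <= `|u| * `|v|.
Proof.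
have : `|u + v| ^+ 2 <= (`|u| + `|v|) ^+ 2.
  by rewrite lerXn2r ?nnegrE ?addr_ge0 // ler_normD.
rewrite sqr_normD; lra.
Qed.

Lemma normr_inner_le u v : `|inner u v| <= `|u| * `|v|.
Proof.
rewrite ler_norml inner_le andbT lerNl.
have -> : - inner u v = inner (-1 *: u) v by rewrite innerZl mulN1r.
by rewrite (le_trans (inner_le _ _)) // scaleN1r normrN.
Qed.

End InnerProduct.

(** Minimize [J u = |u|^2 - 2 f u].  By the parallelogram identity
    [|u - v|^2 = 2 J u + 2 J v - 4 J ((u + v) / 2)], so a minimizing sequence
    is Cauchy; at its limit the first variation [2 (<b, u> - f u)] of [J]
    vanishes. *)
Lemma riesz_representation (R : realType) (X : hilbertType R) (f : X -> R)
    (M : R) :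
  (forall c u v, f (c *: u + v) = c * f u + f v) ->
  (forall u, `|f u| <= M * `|u|) ->
  exists b : X, forall u, f u = inner b u.
Proof.
move=> flin fM.
have fZ c u : f (c *: u) = c * f u.
  have f0 : f 0 = 0.
    by have := flin 1 0 0; rewrite scaler0 addr0 mul1r => f00; lra.
  by rewrite -[X in f X]addr0 flin f0 addr0.
have fD u v : f (u + v) = f u + f v by rewrite -{1}(scale1r u) flin mul1r.
have fB u v : f (u - v) = f u - f v by rewrite -scaleN1r addrC flin; ring.
pose J u := `|u| ^+ 2 - 2 * f u.
have J_ge u : - M ^+ 2 <= J u.
  rewrite /J; have := le_trans (ler_norm _) (fM u).
  have := sqr_ge0 (`|u| - M); lra.
have Jinf : has_inf (range J).
  by split; [exists (J 0), 0|exists (- M ^+ 2) => _ [u _ <-]].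
pose m := inf (range J).
have m_le u : m <= J u by apply: ge_inf; [case: Jinf|exists u].
have /choice[u_ Ju] n : exists u, J u < m + n.+1%:R^-1.
  have [|_ [u _ <-] Ju] := @inf_adherent _ (range J) n.+1%:R^-1 _ Jinf.
    by rewrite invr_gt0.
  by exists u.
have J_para u v : `|u - v| ^+ 2 = 2 * J u + 2 * J v - 4 * J (2^-1 *: (u + v)).
  rewrite /J normrZ exprMn sqr_normB sqr_normD ger0_norm ?invr_ge0 //.
  by rewrite fZ fD; field.
have u_close n p N : (N <= n)%N -> (N <= p)%N ->
    `|u_ n - u_ p| ^+ 2 <= 4 * N.+1%:R^-1.
  move=> Nn Np; rewrite J_para.
  have Jle k : (N <= k)%N -> J (u_ k) <= m + N.+1%:R^-1.
    move=> Nk; rewrite (le_trans (ltW (Ju k))) // lerD2l.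
    by rewrite lef_pV2 ?posrE // ler_nat.
  move: (m_le (2^-1 *: (u_ n + u_ p))) (Jle _ Nn) (Jle _ Np).
  move: (J _) (J _) (J _) (N.+1%:R^-1) => j1 j2 j3 r; lra.
have : cvg (u_ @ \oo).
  apply: cauchy_cvg; apply/cauchy_ballP => e e0; near_simpl.
  have e4 : 0 < 4^-1 * e ^+ 2 by rewrite mulr_gt0 ?exprn_gt0.
  near \oo => N.
  have Ne : 4 * N.+1%:R^-1 < e ^+ 2.
    rewrite -ltr_pdivlMl //; near: N.
    exact: (near_infty_natSinv_lt (PosNum e4)).
  exists ([set n | (N <= n)%N], [set n | (N <= n)%N]) => /=.
    by split; exists N.
  move=> [n p] /= [Nn Np]; rewrite -ball_normE /=.
  rewrite -(@ltr_pXn2r _ 2) ?nnegrE ?normr_ge0 ?(ltW e0) //.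
  exact: le_lt_trans (u_close _ _ _ Nn Np) Ne.
move=> /cvg_ex[b ub]; exists b.
have fu : f (u_ n) @[n --> \oo] --> f b.
  apply: (@cvg_dist_le _ _ _ _ _ _ (fun n => M * `|u_ n - b|)).
    by near=> n; rewrite -fB.
  by rewrite -(mulr0 M); apply: cvgMl_tmp; exact: cvg_dist.
have Jb : J b <= m.
  have Jn_cvg : J (u_ n) - n.+1%:R^-1 @[n --> \oo] --> J b - 0.
    apply: cvgB; last exact: cvg_harmonic.
    apply: cvgB; last by apply: cvgMl_tmp.
    by apply: cvg_sqr; exact: cvg_norm.
  rewrite subr0 in Jn_cvg; apply: (cvgr_to_le Jn_cvg).
  by near=> n; rewrite lerBlDr ltW.
have J_min v t : 0 <= 2 * t * (inner b v - f v) + t ^+ 2 * `|v| ^+ 2.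
  have := le_trans Jb (m_le (b + t *: v)); rewrite /J sqr_normD fD fZ.
  by rewrite innerZr normrZ exprMn real_normK ?num_real //; lra.
move=> v; set d := inner b v - f v; pose q := `|v| ^+ 2.
(* the minimum over t of 2 t d + t^2 (q + 1) is attained at t = - d / (q + 1);
   using q + 1 for q keeps the denominator positive when v = 0 *)
have q1_gt0 : 0 < q + 1 by rewrite ltr_wpDl ?sqr_ge0.
have q1_neq0 : q + 1 != 0 by rewrite gt_eqF.
have := J_min v (- d / (q + 1)); rewrite -/d -/q.
have -> : 2 * (- d / (q + 1)) * d + (- d / (q + 1)) ^+ 2 * q =
    - (d ^+ 2 * ((q + 2) / (q + 1) ^+ 2)) by field.
rewrite oppr_ge0 pmulr_lle0; last first.
  by rewrite divr_gt0 ?exprn_gt0 // ltr_wpDl ?sqr_ge0.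
move=> d2; have /eqP : d ^+ 2 = 0 by apply/eqP; rewrite eq_le d2 sqr_ge0.
by rewrite sqrf_eq0 subr_eq0 => /eqP.
Unshelve. all: by end_near. Qed.

(** * Adjoints and operator norms *)

Section BoundedOperators.
Context {R : realType} {X Y : hilbertType R}.
Implicit Type A : {linear X -> Y}.

Lemma continuous_linear_le A : continuous A ->
  exists M, forall u, `|A u| <= M * `|u|.
Proof.
move=> /linear_bounded_continuous/linear_boundedP A_bnd.
near (pinfty_nbhs R) => M; exists M; near: M; exact: A_bnd.
Unshelve. all: by end_near. Qed.

(** Continuity makes the set whose supremum is [op_norm A] bounded; without it
    the supremum would be a default value. *)
Lemma op_norm_le A : continuous A -> forall u, `|A u| <= op_norm A * `|u|.
Proof.
move=> /continuous_linear_le[M A_le] u.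
have [->|u0] := eqVneq u 0; first by rewrite linear0 !normr0 mulr0.
have u_gt0 : 0 < `|u| by rewrite normr_gt0.
rewrite -ler_pdivrMr //.
have -> : `|A u| / `|u| = `|A (`|u|^-1 *: u)|.
  by rewrite linearZ normrZ normfV normr_id mulrC.
apply: ub_le_sup.
  exists `|M| => _ [v v1 <-]; apply: (le_trans (A_le v)).
  rewrite (le_trans (ler_wpM2r (normr_ge0 v) (ler_norm M))) //.
  by rewrite ler_piMr.
exists (`|u|^-1 *: u) => //=.
by rewrite normrZ normfV normr_id mulVf // gt_eqF.
Qed.

Lemma adjointP A : continuous A -> is_adjoint A (adjoint A).
Proof.
move=> /continuous_linear_le[M A_le].
have /choice[B AB] (v : Y) : exists b : X, forall u, inner (A u) v = inner b u.
  apply: (@riesz_representation _ _ _ (M * `|v|)) => [c u u'|u].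
    by rewrite linearP innerDl innerZl.
  by rewrite (le_trans (normr_inner_le _ _)) // mulrAC ler_wpM2r.
rewrite /adjoint; apply: xgetPex; by exists B => u v; rewrite AB innerC.
Qed.

End BoundedOperators.

(** * Stability of the Levenberg-Marquardt step *)

Section LevenbergMarquardtStep.
Context {R : realType} {X Y : hilbertType R}.

(** The variational form of the equation mentions no adjoint, hence can be
    compared for two different operators. *)
Lemma LM_equation_weak (F : X -> Y) y mu w s : differentiable F w ->
  LM_equation F y mu w s -> forall v,
  inner ('d F w s) ('d F w v) + mu * inner s v = inner (y - F w) ('d F w v).
Proof.
move=> Fw sE v; have /adjointP adj : continuous ('d F w).
  exact: diff_continuous.
rewrite 2!(innerC _ ('d F w v)) !adj -sE innerDr innerZr.
by rewrite (innerC s v).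
Qed.

(** Test the two equations with [e = s' - s] and subtract: with the residuals
    [p = r - A s] and [p' = r' - A' s],
    [mu |e|^2 + |A' e|^2 = <p' - p, A' e> + <p, (A' - A) e>],
    and the term [|A' e|^2] absorbs the factor [A' e] on the right, so that the
    bound is uniform in [A'].  Young's inequality then absorbs the factor [|e|]
    of the last term into [mu |e|^2]. *)
Lemma LM_step_perturbation (A A' : {linear X -> Y}) (mu eps : R)
    (r r' : Y) (s s' : X) :
  0 < mu -> (forall u, `|A' u - A u| <= eps * `|u|) ->
  (forall v, inner (A s) (A v) + mu * inner s v = inner r (A v)) ->
  (forall v, inner (A' s') (A' v) + mu * inner s' v = inner r' (A' v)) ->
  `|s' - s| ^+ 2 <= 2 / mu *
    ((`|r' - r| + eps * `|s|) ^+ 2 + (`|r - A s| * eps) ^+ 2 / (2 * mu)).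
Proof.
move=> mu0 A'A sE s'E; set e := s' - s.
set d := _ + eps * _; set c := _ * eps.
pose p := r - A s; pose p' := r' - A' s.
have d_ge : `|p' - p| <= d.
  have -> : p' - p = (r' - r) - (A' s - A s).
    by rewrite !opprB [A s - A' s]addrC [RHS]addrACA [- r + _]addrC.
  by rewrite (le_trans (ler_normB _ _)) // lerD2l.
have energy : mu * `|e| ^+ 2 + `|A' e| ^+ 2 =
    inner (p' - p) (A' e) + inner p (A' e - A e).
  have : inner r (A e) = inner (A s) (A e) + mu * inner s e by rewrite sE.
  have := s'E e; rewrite -!inner_norm {2 6}/e linearB !(innerBl, innerBr).
  lra.
have young : inner (p' - p) (A' e) <= d ^+ 2 + `|A' e| ^+ 2.
  have := le_trans (inner_le (p' - p) (A' e)) (ler_wpM2r (normr_ge0 _) d_ge).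
  have := sqr_ge0 (d - `|A' e|); have := sqr_ge0 (d + `|A' e|); nra.
have cross : inner p (A' e - A e) <= c * `|e|.
  rewrite (le_trans (inner_le _ _)) // /c -mulrA.
  by rewrite ler_wpM2l.
have bound : mu * `|e| ^+ 2 <= d ^+ 2 + c * `|e| by lra.
have absorb : c * `|e| <= c ^+ 2 / (2 * mu) + mu * `|e| ^+ 2 / 2.
  rewrite -subr_ge0.
  have -> : c ^+ 2 / (2 * mu) + mu * `|e| ^+ 2 / 2 - c * `|e| =
      (c - mu * `|e|) ^+ 2 / (2 * mu) by field; rewrite gt_eqF.
  by rewrite divr_ge0 ?sqr_ge0 // mulr_ge0 // ltW.
rewrite mulrAC ler_pdivlMr // mulrC; lra.
Qed.

(** The alternative [sd j = s] serves the index at which the exact iteration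
    stops: there [s = 0] solves the equation, while a noisy iteration either
    stops too, with zero step, or solves its own equation. *)
Lemma LM_step_cvg (F : X -> Y) (mu : R) (y : Y) (w s : X)
    (yd : nat -> Y) (wd sd : nat -> X) :
  continuously_differentiable F -> 0 < mu ->
  LM_equation F y mu w s ->
  yd j @[j --> \oo] --> y -> wd j @[j --> \oo] --> w ->
  (\forall j \near \oo,
     sd j = s \/ LM_equation F (yd j) mu (wd j) (sd j)) ->
  sd j @[j --> \oo] --> s.
Proof.
move=> [dF cF] mu0 sE ydy wdw sdE.
have Fwd : F (wd j) @[j --> \oo] --> F w.
  by apply: continuous_cvg => //; exact: differentiable_continuous.
pose eps j := op_norm (fun u => 'd F (wd j) u - 'd F w u).
have eps0 : eps j @[j --> \oo] --> (0 : R) by apply: cvg_comp (cF w).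
have eps_le j u : `|'d F (wd j) u - 'd F w u| <= eps j * `|u|.
  have := @op_norm_le _ _ _ ('d F (wd j) \- 'd F w); apply.
  by move=> z; apply: cvgB; apply: diff_continuous.
pose res j := (yd j - F (wd j)) - (y - F w).
have res0 : `|res j| @[j --> \oo] --> (0 : R).
  by apply: cvg_dist; apply: cvgB.
pose g j := 2 / mu * ((`|res j| + eps j * `|s|) ^+ 2 +
  (`|y - F w - 'd F w s| * eps j) ^+ 2 / (2 * mu)).
have g0 : g j @[j --> \oo] --> (0 : R).
  have -> : (0 : R) = 2 / mu * ((0 + 0 * `|s|) ^+ 2 +
    (`|y - F w - 'd F w s| * 0) ^+ 2 / (2 * mu)).
    by rewrite mul0r addr0 mulr0 expr0n /= mul0r addr0 mulr0.
  apply: cvgMl_tmp; apply: cvgD.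
    by apply: cvg_sqr; apply: cvgD => //; apply: cvgMr_tmp.
  by apply: cvgMr_tmp; apply: cvg_sqr; apply: cvgMl_tmp.
apply: (@cvg_dist_le _ _ _ _ _ _ (fun j => Num.sqrt (g j))); last first.
  by rewrite -sqrtr0; apply: continuous_cvg => //; exact: sqrt_continuous.
apply: filterS sdE => j sdE.
suff sdg : `|sd j - s| ^+ 2 <= g j.
  rewrite -(ger0_norm (normr_ge0 _)) -sqrtr_sqr ler_sqrt //.
  by rewrite (le_trans _ sdg) ?sqr_ge0.
case: sdE => [->|sdE].
  rewrite subrr normr0 expr0n /= mulr_ge0 ?divr_ge0 ?(ltW mu0) //.
  by rewrite addr_ge0 ?sqr_ge0 // divr_ge0 ?sqr_ge0 // mulr_ge0 // ltW.
by apply: LM_step_perturbation => //; exact: LM_equation_weak.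
Qed.

End LevenbergMarquardtStep.

(** * Stopping test and inertial step *)

Section StoppingTest.
Context {R : realType} {X Y : hilbertType R}.
Context (F : X -> Y) (y : Y) (thr : R) (w : nat -> X).

Lemma reachedS k : reached F y thr w k.+1 <->
  reached F y thr w k /\ thr < `|F (w k) - y|.
Proof.
split=> [wk|[wk thr_lt] l].
  by split=> [l lk|]; apply: wk => //; exact: ltnW.
by rewrite ltnS leq_eqVlt => /orP[/eqP->//|]; exact: wk.
Qed.

Lemma reached_le_stop k k0 :
  reached F y thr w k -> stops_at F y thr w k0 -> (k <= k0)%N.
Proof.
move=> wk [_ le_thr]; rewrite leqNgt; apply/negP => /wk.
by rewrite ltNge le_thr.
Qed.

Lemma reached_before_stop k :
  (forall k0, stops_at F y thr w k0 -> (k <= k0)%N) -> reached F y thr w k.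
Proof.
move=> k_le; suff wk l : (l <= k)%N -> reached F y thr w l by exact: wk.
elim: l => [//|l IH lk]; have wl := IH (ltnW lk).
apply/reachedS; split => //; rewrite ltNge; apply/negP => le_thr.
by have := k_le l (conj wl le_thr); rewrite leqNgt lk.
Qed.

End StoppingTest.

Lemma inertial_parameter_cvg (R : realType) (X : hilbertType R) (x0 : X)
    (rho alpha : R) (x : nat -> X) (xd : nat -> nat -> X) (k : nat) :
  xd j k @[j --> \oo] --> x k -> xd j k.-1 @[j --> \oo] --> x k.-1 ->
  0 < `|x k - x k.-1| ->
  inertial_parameter x0 rho alpha (xd j) k @[j --> \oo] -->
    inertial_parameter x0 rho alpha x k.
Proof.
move=> xk xk1 d_gt0.
have dd : `|xd j k - xd j k.-1| @[j --> \oo] --> `|x k - x k.-1|.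
  by apply: cvg_norm; apply: cvgB.
have dd_gt0 : \forall j \near \oo, 0 < `|xd j k - xd j k.-1|.
  exact: cvgr_gt dd _ d_gt0.
have d_neq0 : `|x k - x k.-1| != 0 by rewrite gt_eqF.
rewrite {2}/inertial_parameter d_gt0.
pose f j := Num.min (theta k / `|xd j k - xd j k.-1| ^+ 2)
  (Num.min (Num.min (theta k) (rho - `|xd j k - x0|) /
    `|xd j k - xd j k.-1|) alpha).
have fE : \forall j \near \oo,
    f j = inertial_parameter x0 rho alpha (xd j) k.
  by apply: filterS dd_gt0 => j dj_gt0; rewrite /inertial_parameter dj_gt0.
apply: (cvg_trans (near_eq_cvg fE)).
apply: cvg_min.
  apply: cvgMl_tmp; apply: cvgV; first by rewrite expf_neq0.
  exact: cvg_sqr.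
apply: cvg_min; last exact: cvg_cst.
apply: cvgM; last exact: cvgV.
apply: cvg_min; first exact: cvg_cst.
apply: cvgB; first exact: cvg_cst.
by apply: cvg_norm; apply: cvgB => //; exact: cvg_cst.
Qed.

(** Where [x k = x k.-1] the parameters [bd j] need not converge, but they stay
    in [[0, alpha]] and multiply a vector that tends to zero. *)
Lemma inertial_step_cvg (R : realType) (X : hilbertType R) (x0 : X)
    (rho alpha b : R) (x : nat -> X) (xd : nat -> nat -> X) (bd : nat -> R)
    (k : nat) :
  xd j k @[j --> \oo] --> x k -> xd j k.-1 @[j --> \oo] --> x k.-1 ->
  b = inertial_parameter x0 rho alpha x k ->
  (\forall j \near \oo, bd j = inertial_parameter x0 rho alpha (xd j) k /\
    0 <= bd j <= alpha) ->
  xd j k + bd j *: (xd j k - xd j k.-1) @[j --> \oo] -->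
    x k + b *: (x k - x k.-1).
Proof.
move=> xk xk1 bE bdE; apply: cvgD => //.
have dd : xd j k - xd j k.-1 @[j --> \oo] --> x k - x k.-1 by apply: cvgB.
have [x_eq|x_neq] := eqVneq (x k - x k.-1) 0; last first.
  apply: cvgZ => //; rewrite bE.
  have par : inertial_parameter x0 rho alpha (xd j) k @[j --> \oo] -->
      inertial_parameter x0 rho alpha x k.
    by apply: inertial_parameter_cvg => //; rewrite normr_gt0.
  apply: cvg_trans par.
  by apply: near_eq_cvg; apply: filterS bdE => j [-> _].
rewrite x_eq scaler0.
apply: (@cvg_dist_le _ _ _ _ _ _ (fun j => alpha * `|xd j k - xd j k.-1|)).
  apply: filterS bdE => j [_ /andP[bd0 bda]].
  by rewrite subr0 normrZ ger0_norm // ler_wpM2r.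
rewrite -(mulr0 alpha) -(@normr0 _ X) -x_eq.
by apply: cvgMl_tmp; exact: cvg_norm.
Qed.

(** * Stability of the iteration *)

Section Stability.
Context {R : realType} {X Y : hilbertType R}.
Context (F : X -> Y) (x0 : X) (rho alpha : R) (lam : nat -> R).
Context (y : Y) (x w s : nat -> X) (a : nat -> R).
Context (thr : nat -> R) (yd : nat -> Y).
Context (xd wd sd : nat -> nat -> X) (ad : nat -> nat -> R).
Context (F_C1 : continuously_differentiable F) (lam_gt0 : forall k, 0 < lam k)
  (thr_cvg : thr j @[j --> \oo] --> (0 : R))
  (yd_cvg : yd j @[j --> \oo] --> y)
  (noisy_inLM : forall j,
    inLM F (yd j) (thr j) x0 alpha lam (xd j) (wd j) (sd j) (ad j))
  (noisy_rule : forall j,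
    inertial_rule F (yd j) (thr j) x0 rho alpha (xd j) (wd j) (ad j))
  (exact_inLM : inLM F y 0 x0 alpha lam x w s a)
  (exact_rule : inertial_rule F y 0 x0 rho alpha x w a).

Let noisy_reached k :=
  \forall j \near \oo, reached F (yd j) (thr j) (wd j) k.

Lemma residual_cvg k : wd j k @[j --> \oo] --> w k ->
  `|F (wd j k) - yd j| @[j --> \oo] --> `|F (w k) - y|.
Proof.
move=> wk; apply: cvg_norm; apply: cvgB => //.
by apply: continuous_cvg => //; apply: differentiable_continuous; case: F_C1.
Qed.

Lemma noisy_reachedS k : reached F y 0 w k.+1 -> noisy_reached k ->
  wd j k @[j --> \oo] --> w k -> noisy_reached k.+1.
Proof.
move=> /reachedS[_ res_gt0] nk wk.
have diff_cvg :
    `|F (wd j k) - yd j| - thr j @[j --> \oo] --> `|F (w k) - y| - 0.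
  by apply: cvgB => //; exact: residual_cvg.
rewrite subr0 in diff_cvg.
apply: filterS2 nk (cvgr_gt _ diff_cvg _ res_gt0) => j nk.
by rewrite subr_gt0 => lt_res; apply/reachedS.
Qed.

Lemma LM_iterate_cvg k : reached F y 0 w k -> noisy_reached k ->
  wd j k @[j --> \oo] --> w k -> xd j k.+1 @[j --> \oo] --> x k.+1.
Proof.
move=> rk nk wk; case: exact_inLM => _ _ /(_ k rk) exact_k.
have xE : x k.+1 = w k + s k.
  by move: exact_k; case: ifP => _ [] // -> ->; rewrite addr0.
have noisy_k : \forall j \near \oo, xd j k.+1 = wd j k + sd j k /\
    (sd j k = 0 \/ thr j < `|F (wd j k) - yd j| /\
      LM_equation F (yd j) (lam k) (wd j k) (sd j k)).
  apply: filterS nk => j nkj; case: (noisy_inLM j) => _ _ /(_ k nkj).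
  case: ifP => lt_res; first by move=> [sE xE' _ _]; split; [|right].
  by move=> [-> ->]; rewrite addr0; split; [|left].
have sk : sd j k @[j --> \oo] --> s k.
  move: exact_k; case: ifP => [res_gt0 [sE _ _ _]|res_le0 [sk0 _]].
    apply: (LM_step_cvg _ _ _ _ _ _ _ _ F_C1 (lam_gt0 k) sE yd_cvg wk).
    have nSk : noisy_reached k.+1.
      by apply: noisy_reachedS => //; apply/reachedS.
    apply: filterS2 nSk nk => j /reachedS[_ lt_res] nkj.
    by case: (noisy_inLM j) => _ _ /(_ k nkj); rewrite lt_res => -[]; right.
  (* the exact iteration stops at k *)
  have res0 : y = F (w k).
    apply/eqP; rewrite eq_sym -subr_eq0 -normr_eq0; move: res_le0.
    by rewrite lt_neqAle normr_ge0 andbT eq_sym => /negbFE.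
  have sE : LM_equation F y (lam k) (w k) 0.
    by rewrite /LM_equation linear0 scaler0 addr0 -res0 subrr.
  rewrite sk0.
  apply: (LM_step_cvg _ _ _ _ _ _ _ _ F_C1 (lam_gt0 k) sE yd_cvg wk).
  by apply: filterS noisy_k => j [_ [->|[_ ?]]]; [left|right].
rewrite xE; apply: cvg_trans (cvgD wk sk).
by apply: near_eq_cvg; apply: filterS noisy_k => j [-> _].
Qed.

Lemma iterates_cvg k : reached F y 0 w k ->
  [/\ noisy_reached k, xd j k @[j --> \oo] --> x k &
      wd j k @[j --> \oo] --> w k].
Proof.
elim: k => [|k IH] rSk.
  have [x_0 w_0 _] := exact_inLM.
  have xd_0 j : xd j 0 = x0 by case: (noisy_inLM j).
  have wd_0 j : wd j 0 = x0 by case: (noisy_inLM j).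
  split; first by near=> j.
  - by under eq_fun do rewrite xd_0; rewrite x_0; exact: cvg_cst.
  - by under eq_fun do rewrite wd_0; rewrite w_0; exact: cvg_cst.
have /reachedS[rk res_gt0] := rSk.
have [nk xk wk] := IH rk.
have nSk := noisy_reachedS k rSk nk wk.
have xSk := LM_iterate_cvg k rk nk wk.
split => //; case: exact_inLM => _ _ /(_ k rk); rewrite res_gt0 => -[_ _ _ ->].
have noisy_k : \forall j \near \oo,
    (ad j k.+1 = inertial_parameter x0 rho alpha (xd j) k.+1 /\
      0 <= ad j k.+1 <= alpha) /\
    wd j k.+1 = xd j k.+1 + ad j k.+1 *: (xd j k.+1 - xd j k).
  apply: filterS nSk => j nSkj; have /reachedS[nkj lt_res] := nSkj.
  case: (noisy_inLM j) => _ _ /(_ k nkj).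
  by rewrite lt_res (noisy_rule j) // => -[].
have step_cvg :
    xd j k.+1 + ad j k.+1 *: (xd j k.+1 - xd j k) @[j --> \oo] -->
    x k.+1 + a k.+1 *: (x k.+1 - x k).
  apply: (inertial_step_cvg _ _ x0 rho alpha _ _ _ _ k.+1 xSk xk).
    exact: exact_rule.
  by apply: filterS noisy_k => j [].
apply: cvg_trans step_cvg.
by apply: near_eq_cvg; apply: filterS noisy_k => j [_ ->].
Unshelve. all: by end_near. Qed.

End Stability.

Theorem theorem2p14 (R : realType) (X Y : hilbertType R) (F : X -> Y)
    (x0 : X) (rho C alpha eta q tau : R) (lam : nat -> R)
    (y : Y) (x w s : nat -> X) (a : nat -> R)
    (delta : nat -> R) (yd : nat -> Y)
    (xd wd sd : nat -> nat -> X) (ad : nat -> nat -> R) (kstar : nat -> nat)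
    (rho_gt0 : 0 < rho)
    (F_C1 : continuously_differentiable F)
    (C_gt0 : 0 < C)
    (dF_le : forall z : X, `|z - x0| <= rho -> op_norm ('d F z) <= C)
    (alpha_ge0 : 0 <= alpha) (alpha_lt1 : alpha < 1)
    (lam_gt0 : forall k, 0 < lam k)
    (eta_ge0 : 0 <= eta) (eta_lt1 : eta < 1)
    (eta_lt_q : eta < q) (q_lt1 : q < 1)
    (tau_gt : (eta + 1) / (q - eta) < tau)
    (y_range : range F y)
    (delta_gt0 : forall j, 0 < delta j)
    (delta_cvg : delta j @[j --> \oo] --> (0 : R))
    (yd_le : forall j, `|yd j - y| <= delta j)
    (noisy_inLM : forall j,
      inLM F (yd j) (tau * delta j) x0 alpha lam (xd j) (wd j) (sd j) (ad j))
    (noisy_rule : forall j,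
      inertial_rule F (yd j) (tau * delta j) x0 rho alpha
        (xd j) (wd j) (ad j))
    (noisy_stop : forall j,
      stops_at F (yd j) (tau * delta j) (wd j) (kstar j))
    (exact_inLM : inLM F y 0 x0 alpha lam x w s a)
    (exact_rule : inertial_rule F y 0 x0 rho alpha x w a) :
  forall k : nat,
    ((forall k0, stops_at F y 0 w k0 -> (k <= k0.+1)%N) ->
       lim_along [set j | (k <= (kstar j).+1)%N] (fun j => xd j k) (x k)) /\
    ((forall k0, stops_at F y 0 w k0 -> (k <= k0)%N) ->
       lim_along [set j | (k <= kstar j)%N] (fun j => wd j k) (w k)).
Proof.
move=> k.
have thr_cvg : tau * delta j @[j --> \oo] --> (0 : R).
  by rewrite -(mulr0 tau); apply: cvgMl_tmp.
have yd_cvg : yd j @[j --> \oo] --> y.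
  by apply: (@cvg_dist_le _ _ _ _ _ _ delta) => //; near=> j.
have reached_cvg := iterates_cvg F x0 rho alpha lam y x w s a _ yd xd wd sd ad
  F_C1 lam_gt0 thr_cvg yd_cvg noisy_inLM noisy_rule exact_inLM exact_rule.
(* the noisy iterates in question exist for almost all j, so that their limit
   along these j is an ordinary one *)
have lim_cofinite (D : set nat) (u : nat -> X) l :
    (\forall j \near \oo, D j) -> u j @[j --> \oo] --> l -> lim_along D u l.
  move=> D_near ul; split; first exact: near_infinite.
  exact: cvg_trans (cvg_app _ (cvg_within _)) ul.
have le_kstar i : reached F y 0 w i -> \forall j \near \oo, (i <= kstar j)%N.
  move=> /reached_cvg[ni _ _]; apply: filterS ni => j nij.
  exact: reached_le_stop nij (noisy_stop j).
split=> k_le; last first.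
  have rk := reached_before_stop _ _ _ _ _ k_le.
  by apply: lim_cofinite; [exact: le_kstar|case: (reached_cvg k rk)].
case: k k_le => [_|k k_le].
  have r0 : reached F y 0 w 0 by [].
  apply: lim_cofinite; first by near=> j.
  by case: (reached_cvg 0%N r0).
have rk := reached_before_stop _ _ _ _ _ k_le.
have [nk _ wk] := reached_cvg k rk.
apply: lim_cofinite; first exact: le_kstar.
exact: (LM_iterate_cvg F x0 alpha lam y x w s a _ yd xd wd sd ad F_C1 lam_gt0
  thr_cvg yd_cvg noisy_inLM exact_inLM).
Unshelve. all: by end_near. Qed.
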